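(* Let $\ell \ge 9$ be an integer that is divisible by $3$ and not divisible by $4$. For every $\varepsilon > 0$ there exist $\gamma > 0$ and $n_0$ such that every oriented graph $H$ on $n \ge n_0$ vertices with $\delta^\pm(H) \ge \frac{n}{4} - \gamma n$ that does not contain a closed walk of length $\ell$ can be made bipartite by removing at most $\varepsilon n$ vertices.
   Context: An oriented graph is a finite directed graph without loops and without multiple edges regardless of direction (at most one of $uw$, $wu$ is an edge). $\delta^\pm(H)$, the minimum semidegree, is the minimum of the minimum outdegree and the minimum indegree of $H$. Walks are directed walks; a walk of length $\ell$ has $\ell$ edges (counted with repetition). An oriented graph is bipartite if its underlying undirected graph is bipartite. *)

(* Defs.v *)
From mathcomp Require Import all_boot all_order all_algebra.
From mathcomp Require Import reals.

Set Implicit Arguments.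
Unset Strict Implicit.
Unset Printing Implicit Defensive.

Section Digraphs.
Variables (T : finType) (e : rel T).

Definition oriented : Prop :=
  irreflexive e /\ forall x y : T, ~~ (e x y && e y x).

Definition outdegree (x : T) : nat := #|[set y | e x y]|.

Definition indegree (x : T) : nat := #|[set y | e y x]|.

(* Every degree is at most #|T|, so the unit #|T| of the iterated minimum does
   not affect its value as soon as T is nonempty. *)
Definition min_semidegree : nat :=
  \big[minn/#|T|]_(x : T) minn (outdegree x) (indegree x).

Definition has_closed_walk (l : nat) : Prop :=
  exists (x : T) (p : seq T), [/\ path e x p, size p = l & last x p = x].

Definition underlying : rel T := [rel x y | e x y || e y x].

Definition bipartite : Prop :=
  exists A : {set T}, forall x y : T, underlying x y -> (x \in A) != (y \in A).

Definition induced (U : {set T}) : rel {x : T | x \in U} :=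
  [rel u v | e (val u) (val v)].

End Digraphs.

Arguments induced {T} e U.

(* Main.v *)
Require Import Defs.
From mathcomp Require Import all_boot all_order all_algebra.
From mathcomp Require Import reals zify lra.

(** Write n for the order of the graph e and d for its minimum semidegree, so
    that n <= 4 * d + g with g tiny compared to d.  The graph turns out to be
    bipartite as it stands, so the empty set is removed.

    Since 3 divides l, going round a directed triangle l / 3 times shows that
    there are no directed triangles.  Call an edge a -> c a shortcut if
    a -> b -> c for some b.  If there are no shortcuts either, the underlying
    graph is triangle-free with minimum degree at least 2 * d > 2 * n / 5, hence
    bipartite by the argument of Andrasfai, Erdos and Sos
    (no_shortcut_bipartite).  So everything lies in excluding shortcuts.

    Two growth facts are used throughout.  First, a set X of vertices contains a
    vertex with few out-neighbours in X (sparse_vertex), so X together with its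
    out-neighbours has at least d + 3/5 |X| vertices (expansion); hence any two
    vertices are joined by a walk of length at most 8.  Secondly, every
    out-neighbourhood is acyclic (sink): if one could walk for ever inside
    N+(a), then a would reach some vertex by walks of all lengths, and a short
    walk back to a would close one of them to length l.  A sink s of N+(a) has
    N+(s) disjoint from N+(a), so the vertices at distance at most 2 from a make
    up half of the graph, and by one more expansion there is between any two
    vertices a walk with length in any prescribed window of four integers
    (window).  In particular three consecutive shortcuts, which give walks of
    lengths 3, 4, 5 and 6, would close up to length l (three_shortcuts).

    If a -> c is a shortcut and c reaches a in k steps, then there are closed
    walks of lengths k + 1 and k + 2 at a.  For k = 3 these lengths are 4 and 5,
    which add up to every l in question; for k = 4 they are 5 and 6, which do
    except for l = 9.  In the case l = 9, k = 4, no closed walk of length 4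
    meets the closed walks of length 5, so at the vertices v of the latter the
    balls of radius 2 around v in the two directions are disjoint and each is
    half of the graph; this rigidity is contradictory (no_nine_walk4).

    Hence c never reaches a in fewer than 5 steps (remote), and the out-ball of
    radius 2 of c and the in-ball of radius 2 of a split the vertex set into
    halves.  Then N+(c) and N-(a) are independent, every vertex of N+(c) is
    joined to every vertex of N-(a) by a walk of length 3, and there is no room
    left for the neighbours of the midpoint b (remote_no_shortcut).

    The contradictions are all of two kinds: about half of the vertices send
    their edges to hardly more than half of the vertices, against expansion, or
    a few sets of known size are disjoint and do not fit into the graph. *)

Set Implicit Arguments.
Unset Strict Implicit.

(** * Walks *)

Section Walks.
Variable T : finType.
Implicit Types (e : rel T) (x y z : T).

Fixpoint walk e k x y : bool :=
  if k is k'.+1 then [exists z, e x z && walk e k' z y] else x == y.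

Definition converse e : rel T := fun x y => e y x.

Lemma walk0 e x : walk e 0 x x.
Proof. exact: eqxx. Qed.

Lemma walkS e k x y z : e x y -> walk e k y z -> walk e k.+1 x z.
Proof. by move=> xy yz; apply/existsP; exists y; rewrite xy. Qed.

Lemma walk1 e x y : walk e 1 x y = e x y.
Proof.
apply/existsP/idP => [[z /andP[xz /eqP<-]] // | xy].
by exists y; rewrite xy /= eqxx.
Qed.

Lemma walkD e i j x y z : walk e i x y -> walk e j y z -> walk e (i + j) x z.
Proof.
elim: i x => [|i IH] x /= => [/eqP-> // | /existsP[w /andP[xw wy]] yz].
exact: walkS xw (IH _ wy yz).
Qed.

Lemma walk_split e i j x z :
  walk e (i + j) x z -> exists2 y, walk e i x y & walk e j y z.
Proof.
elim: i x => [|i IH] x; first by exists x => //=.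
case/existsP=> w /andP[xw /IH[y wy yz]]; exists y => //; exact: walkS xw wy.
Qed.

Lemma walk_rcons e k x y z : walk e k x y -> e y z -> walk e k.+1 x z.
Proof. by move=> xy yz; rewrite -addn1; apply: walkD xy _; rewrite walk1. Qed.

Lemma walk_converse e k x y : walk (converse e) k x y = walk e k y x.
Proof.
have half e' : forall k' x' y', walk e' k' x' y' -> walk (converse e') k' y' x'.
  elim=> [|k' IH] x' y' /=; first by rewrite eq_sym.
  case/existsP=> z /andP[xz /IH zy].
  exact: walk_rcons zy xz.
by apply/idP/idP; exact: half.
Qed.

Lemma walk_mul e k m x : walk e k x x -> walk e (m * k) x x.
Proof.
by move=> h; elim: m => [|m IH] /=; rewrite ?mulSn //; exact: walkD h IH.
Qed.

Lemma walk_closed e k x : walk e k x x -> has_closed_walk e k.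
Proof.
have aux : forall k' x' y', walk e k' x' y' ->
    exists p, [/\ path e x' p, size p = k' & last x' p = y'].
  elim=> [|k' IH] x' y' /=; first by move/eqP=> <-; exists [::].
  case/existsP=> z /andP[xz /IH[p [pp <- lp]]].
  by exists (z :: p); rewrite /= xz.
by move=> /aux[p hp]; exists x, p.
Qed.

End Walks.

Arguments walk : simpl never.

Lemma walk2 (T : finType) (e : rel T) x y z : e x y -> e y z -> walk e 2 x z.
Proof. by move=> xy yz; apply: walkS xy _; rewrite walk1. Qed.

Lemma walk3 (T : finType) (e : rel T) x y z w :
  e x y -> e y z -> e z w -> walk e 3 x w.
Proof. by move=> xy yz zw; apply: walkS xy (walk2 yz zw). Qed.

Lemma walk2P (T : finType) (e : rel T) x z :
  walk e 2 x z -> exists2 y, e x y & e y z.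
Proof. by case/(@walk_split _ e 1 1)=> y; rewrite !walk1; exists y. Qed.

(** * Counting *)

(** A linear inequality between cardinals follows from the pointwise inequality
    between indicator functions; all counting below is done in this way.  With R
    empty and k = 1, for instance, the sets of L are disjoint. *)
Lemma card_indicator (T : finType) (L R : seq {set T}) k :
  (forall x, sumn [seq (x \in A : nat) | A : {set T} <- L]
             <= sumn [seq (x \in A : nat) | A : {set T} <- R] + k) ->
  sumn [seq #|A : {set T}| | A <- L] <= sumn [seq #|A : {set T}| | A <- R] + k * #|[set: T]|.
Proof.
move=> h.
have sumE (M : seq {set T}) :
    sumn [seq #|A : {set T}| | A <- M] = \sum_x sumn [seq (x \in A : nat) | A : {set T} <- M].
  elim: M => [|A M IH] /=; first by rewrite big1.
  by rewrite big_split /= -IH -sum1_card [in LHS]big_mkcond.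
rewrite cardsT !sumE mulnC -sum_nat_const -big_split /=.
by apply: leq_sum => x _; exact: h.
Qed.

(** Leaves two goals: the use of the inequality, and its pointwise version. *)
Ltac count L R k :=
  let h := fresh in
  have h := @card_indicator _ L R k; simpl in h;
  lapply h; clear h; [ | let u := fresh "u" in intro u; rewrite ?inE ].

Ltac case_atom b :=
  lazymatch b with
  | andb ?x _ => case_atom x
  | orb ?x _ => case_atom x
  | negb ?x => case_atom x
  | leq _ _ => fail
  | true => fail
  | false => fail
  | _ => case: b
  end.

(** Propositional reasoning on boolean atoms by case distinction.  It looks at
    the goal only, so the facts to be used are pushed there first. *)
Ltac truth_table :=
  clear;
  repeat (match goal with
    | |- context [is_true ?b] => case_atom b
    | |- context [nat_of_bool ?b] => case_atom b
    end; rewrite //=);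
  intros;
  match goal with
  | H : is_true true -> False |- _ => case (H isT)
  | H : is_true true -> is_true true -> False |- _ => case (H isT isT)
  | H : is_true true -> is_true true -> is_true true -> False |- _ =>
      case (H isT isT isT)
  | H : is_true true -> is_true false |- _ => discriminate (H isT)
  | H : is_true true -> is_true true -> is_true false |- _ => discriminate (H isT isT)
  | H : is_true false |- _ => discriminate H
  end.

(** Linear arithmetic from the inequalities in the context alone. *)
Ltac cards :=
  repeat match goal with X := _ |- _ => clearbody X end;
  repeat match goal with H : is_true (leq _ _) |- _ => revert H end;
  clear; lia.

(** * Dense graphs without directed triangles and closed l-walks *)

Notation outs e x := [set y | e x y].
Notation ins e x := [set y | e y x].
Notation outs2 e x := [set y | e x y || walk e 2 x y].
Notation ins2 e x := [set y | e y x || walk e 2 y x].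

(** The setting of the whole proof.  It is invariant under reversing all edges,
    which halves the work; the constant 100 is a convenient bound on the error
    terms that the counting arguments accumulate. *)
Record dense (T : finType) (e : rel T) (l d g : nat) : Prop := Dense {
  dense_asym : forall x y, e x y -> e y x -> False;
  dense_tri : forall x y z, e x y -> e y z -> e z x -> False;
  dense_out : forall x, d <= #|outs e x|;
  dense_in : forall x, d <= #|ins e x|;
  dense_card : #|[set: T]| <= 4 * d + g;
  dense_gap : 100 * g < d;
  dense_len : 9 <= l;
  dense_walk : forall x, walk e l x x -> False }.

Lemma dense_converse T e l d g : @dense T e l d g -> @dense T (converse e) l d g.
Proof.
case=> asym tri dout din card gap len cl; split=> //.
- by move=> x y xy yx; exact: asym yx xy.
- by move=> x y z xy yz zx; exact: (tri y x z).
- by move=> x; rewrite walk_converse => /cl.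
Qed.

(** * Growth of neighbourhoods *)

Section Degrees.
Variables (T : finType) (e : rel T).
Implicit Types (x y z : T) (X Y : {set T}).

Lemma sum_degrees X :
  \sum_(x in X) #|[set y in X | e x y]| = \sum_(x in X) #|[set y in X | e y x]|.
Proof.
have cE (f : rel T) x : #|[set y in X | f x y]| = \sum_(y in X) f x y.
  by rewrite -sum1_card big_mkcond [RHS]big_mkcond; apply: eq_bigr => y _;
     rewrite inE; case: (y \in X); case: (f x y).
under eq_bigr => x _ do rewrite (cE e).
under [RHS]eq_bigr => x _ do rewrite (cE (fun u v => e v u)).
exact: exchange_big.
Qed.

Lemma half_degree X : (forall x y, e x y -> e y x -> False) -> 0 < #|X| ->
  exists2 x, x \in X & 2 * #|[set y in X | e x y]| <= #|X|.
Proof.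
move=> asym X0; apply/exists_inP; apply: contraT; rewrite negb_exists_in.
move/forall_inP=> h.
have: \sum_(x in X) (#|[set y in X | e x y]| + #|[set y in X | e y x]|)
      <= \sum_(x in X) #|X|.
  apply: leq_sum => x _.
  count [:: [set y in X | e x y]; [set y in X | e y x]] [:: X] 0; first lia.
  by move: (asym x u); lia.
rewrite big_split /= -sum_degrees sum_nat_const.
have: \sum_(x in X) #|X| <  \sum_(x in X) (2 * #|[set y in X | e x y]|).
  case/card_gt0P: X0 => x0 x0X.
  apply: (@leq_trans (\sum_(x in X) (#|X| + (x == x0)))); last first.
    apply: leq_sum => x xX; move: (h x xX); case: (x == x0); lia.
  rewrite big_split /= [X in _ < _ + X](bigD1 x0) //= eqxx; lia.
rewrite sum_nat_const -big_distrr /=; lia.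
Qed.
End Degrees.

Section Growth.
Variables (T : finType) (e : rel T) (l d g : nat).
Hypothesis D : dense e l d g.
Implicit Types (x y z : T) (X Y : {set T}).

Let asym := dense_asym D.
Let tri := dense_tri D.

(** Caccetta and Haggkvist: let m have the least outdegree r in X.  Some v in X
    has indegree at least r, and some w in N+(v) sends at most half of |N+(v)|
    edges into N+(v).  Then N-(v), N+(v) and N+(w) minus N+(v) are disjoint by
    triangle-freeness, so that |X| >= r + |N+(v)| + (r - |N+(v)| / 2). *)
Lemma sparse_vertex X : 0 < #|X| ->
  exists2 x, x \in X & 5 * #|[set y in X | e x y]| <= 2 * #|X|.
Proof.
move=> X0; case/card_gt0P: (X0) => x0 x0X.
case: (arg_minnP (fun x => #|[set y in X | e x y]|) x0X) => m mX mmin.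
exists m => //; set r := #|[set y in X | e m y]| in mmin *.
have [v vX vin] : exists2 v, v \in X & r <= #|[set y in X | e y v]|.
  apply/exists_inP; apply: contraT; rewrite negb_exists_in => /forall_inP h.
  have : \sum_(x in X) r <= \sum_(x in X) #|[set y in X | e x y]| by apply: leq_sum => x /mmin.
  have : \sum_(x in X) #|[set y in X | e y x]| + #|X| <= \sum_(x in X) r.
    rewrite -sum1_card -big_split; apply: leq_sum => x /h /=; lia.
  rewrite -sum_degrees; lia.
have [Y0|Y0] := posnP #|[set y in X | e v y]|.
  by move: (mmin v vX); rewrite Y0; lia.
have [w wY wh] := half_degree asym Y0.
move: wY; rewrite inE => /andP[wX vw].
count [:: [set y in X | e y v]; [set y in X | e v y]; [set y in X | e w y]]
   [:: X; [set y in [set y in X | e v y] | e w y]] 0.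
  by move: (mmin v vX) (mmin w wX) vin wh => /=; lia.
by move: (@asym v u) (@tri v w u); lia.
Qed.

(** Y plays the role of X together with its out-neighbourhood. *)
Lemma expansion X Y : 0 < #|X| -> (forall x, x \in X -> x \in Y) ->
  (forall x y, x \in X -> e x y -> y \in Y) -> 5 * d + 3 * #|X| <= 5 * #|Y|.
Proof.
move=> X0 XY eXY; have [v vX hv] := sparse_vertex X0.
count [:: X; [set y | e v y]] [:: Y; [set y in X | e v y]] 0.
  by have := dense_out D v; lia.
by move: (XY u) (eXY v u vX); lia.
Qed.

End Growth.

(** * Shortcuts, sinks and the flexibility of walks *)

(** An edge a -> c that can be replaced by a walk of length 2. *)
Definition shortcut (T : finType) (e : rel T) a c := e a c && walk e 2 a c.

Lemma shortcutP (T : finType) (e : rel T) a b c :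
  e a b -> e b c -> e a c -> shortcut e a c.
Proof. by move=> ab bc ac; rewrite /shortcut ac; apply: walkS ab _; rewrite walk1. Qed.

Lemma shortcut_mid (T : finType) (e : rel T) a c :
  shortcut e a c -> exists b, [/\ e a b, e b c & e a c].
Proof.
by case/andP=> ac /(@walk_split _ e 1 1)[b]; rewrite !walk1; exists b.
Qed.

Lemma shortcut_converse (T : finType) (e : rel T) a c :
  shortcut (converse e) a c = shortcut e c a.
Proof. by rewrite /shortcut walk_converse. Qed.

Section Reach.
Variables (T : finType) (l d g : nat).
Implicit Types (e : rel T) (x y z : T) (X Y : {set T}).

(** The constant is 1 + 3/5 + (3/5)^2 + (3/5)^3 = 272/125; since twice this
    exceeds 4, balls of radius 4 around two vertices meet. *)
Lemma wide_ball e x : dense e l d g -> exists2 B : {set T}, 272 * d <= 125 * #|B| &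
  forall y, y \in B -> exists2 k, 0 < k <= 4 & walk e k x y.
Proof.
move=> D; have dg := dense_gap D.
have step i (B : {set T}) : d <= #|B| ->
    (forall y, y \in B -> exists2 k, 0 < k <= i & walk e k x y) ->
  exists2 C : {set T}, 5 * d + 3 * #|B| <= 5 * #|C| &
    forall y, y \in C -> exists2 k, 0 < k <= i.+1 & walk e k x y.
  move=> dB hB; exists (B :|: [set y | [exists z in B, e z y]]).
    apply: (expansion D); first lia.
      by move=> y yB; rewrite inE yB.
    by move=> y z yB yz; rewrite !inE; apply/orP; right; apply/exists_inP; exists y.
  move=> y; rewrite !inE => /orP[/hB[k hk kw]|]; first by exists k => //; lia.
  case/exists_inP=> z /hB[k hk kw] zy; exists k.+1; [lia | exact: walk_rcons kw zy].
have [|B2 c2 h2] := step 1 [set y | e x y] (dense_out D x).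
  by move=> y; rewrite inE => xy; exists 1; rewrite ?walk1.
have d1 := dense_out D x.
have [|B3 c3 h3] := step 2 B2 _ h2; first lia.
have [|B4 c4 h4] := step 3 B3 _ h3; first lia.
by exists B4 => //; lia.
Qed.

Variable e : rel T.
Hypothesis D : dense e l d g.

Lemma short_walk x y : exists2 k, 2 <= k <= 8 & walk e k x y.
Proof.
have [B cB hB] := wide_ball x D; have [C cC hC] := wide_ball y (dense_converse D).
have [z zB zC] : exists2 z, z \in B & z \in C.
  apply/exists_inP; apply: contraT; rewrite negb_exists_in => /forall_inP h.
  count [:: B; C] (@nil {set T}) 1; last by move: (h u); lia.
  have := dense_card D; have := dense_gap D; lia.
have [i hi wi] := hB z zB; have [j hj wj] := hC z zC.
exists (i + j); [lia | apply: walkD wi _; by rewrite walk_converse in wj].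
Qed.

(** If every vertex of X has an out-neighbour in X, walk l steps inside X and
    let c be the end.  As a is joined to each vertex of this walk, there are
    walks of all lengths up to l from a to c. *)
Lemma sink a X : 0 < #|X| -> (forall x, x \in X -> e a x) ->
  exists2 s, s \in X & forall y, y \in X -> ~~ e s y.
Proof.
move=> X0 aX.
suff: [exists s in X, [forall y in X, ~~ e s y]].
  by case/exists_inP=> s sX /forall_inP h; exists s.
apply: contraT; rewrite negb_exists_in => /forall_inP h.
have [c cX cw] : exists2 c, c \in X & forall j, 0 < j <= l -> walk e j a c.
  have : forall m, exists2 c, c \in X & forall j, 0 < j <= m.+1 -> walk e j a c.
    elim=> [|m [c cX cw]].
      case/card_gt0P: X0 => c cX; exists c => // j hj.
      have ->: j = 1 by lia.
      by rewrite walk1 aX.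
    have := h c cX; rewrite negb_forall_in => /exists_inP[c' c'X]; rewrite negbK => cc'.
    exists c' => // -[|[|j]] hj //; first by rewrite walk1 aX.
    by apply: walk_rcons cc'; apply: cw; lia.
  move=> /(_ l)[c cX cw]; exists c => // j hj; apply: cw; lia.
have [k hk kw] := short_walk c a.
have hl := dense_len D.
case: (@dense_walk _ _ _ _ _ D a).
have ->: l = (l - k) + k by lia.
by apply: walkD kw; apply: cw; lia.
Qed.

(** Out-neighbours of a having an in-neighbour in N+(a) are ends of shortcuts,
    so a sink among these is a sink of all of N+(a). *)
Lemma shortcut_sink a c : shortcut e a c ->
  exists2 s, shortcut e a s & forall y, e a y -> e s y -> False.
Proof.
move=> ac.
have [||s] := @sink a [set y | shortcut e a y].
- by apply/card_gt0P; exists c; rewrite inE.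
- by move=> x; rewrite inE => /andP[].
rewrite inE => sa h; exists s => // y ay sy.
case/andP: sa => as_ _.
by move: (h y); rewrite inE sy (shortcutP as_ sy ay) => /(_ isT).
Qed.

Lemma out_nonempty x : exists y, e x y.
Proof.
have /card_gt0P[y] : 0 < #|[set y | e x y]|.
  by have := dense_out D x; have := dense_gap D; lia.
by rewrite inE => xy; exists y.
Qed.

Lemma walk_exists k x : exists y, walk e k x y.
Proof.
elim: k => [|k [y xy]]; first by exists x; exact: walk0.
by have [z yz] := out_nonempty y; exists z; exact: walk_rcons xy yz.
Qed.

(** If w is reached in i steps, then N+(w) and N+(s), for a sink s of N+(w),
    are disjoint. *)
Lemma two_levels i x :
  2 * d <= #|[set y | walk e i.+1 x y || walk e i.+2 x y]|.
Proof.
have [w xw] := walk_exists i x.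
have [||s] := @sink w [set y | e w y].
- by have := dense_out D w; have := dense_gap D; lia.
- by move=> y; rewrite inE.
rewrite inE => ws hs.
count [:: [set y | e w y]; [set y | e s y]]
  [:: [set y | walk e i.+1 x y || walk e i.+2 x y]] 0.
  by have := dense_out D w; have := dense_out D s; lia.
move: (hs u) (@walk_rcons _ e _ _ _ u xw) (@walk_rcons _ e _ _ _ u (walk_rcons xw ws)).
by rewrite !inE; lia.
Qed.

Lemma three_levels i x : 11 * d <=
  5 * #|[set y | [|| walk e i.+1 x y, walk e i.+2 x y | walk e i.+3 x y]]|.
Proof.
have h := two_levels i x; have dg := dense_gap D.
suff : 5 * d + 3 * #|[set y | walk e i.+1 x y || walk e i.+2 x y]| <=
   5 * #|[set y | [|| walk e i.+1 x y, walk e i.+2 x y | walk e i.+3 x y]]| by lia.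
apply: (expansion D); first lia.
  by move=> y; rewrite !inE; lia.
by move=> y z; rewrite !inE => /orP[] xy yz; rewrite (walk_rcons xy yz) ?orbT.
Qed.

End Reach.

Section Windows.
Variables (T : finType) (e : rel T) (l d g : nat).
Hypothesis D : dense e l d g.
Implicit Types (x y z : T).

(** The targets reached in 1, 2 or 3 steps from x are more than 2 * d in number,
    those that reach y in s - 1 or s steps at least 2 * d. *)
Lemma window x y s : 2 <= s -> exists2 k, s <= k <= s + 3 & walk e k x y.
Proof.
move=> s2.
have h3 := three_levels D 0 x; have h2 := two_levels (dense_converse D) (s - 2) y.
set B := [set y | _] in h3; set C := [set y | _] in h2.
have [z zB zC] : exists2 z, z \in B & z \in C.
  apply/exists_inP; apply: contraT; rewrite negb_exists_in => /forall_inP h.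
  count [:: B; C] (@nil {set T}) 1; last by move: (h u); rewrite !inE; lia.
  have := dense_card D; have := dense_gap D; lia.
have [i hi wi] : exists2 i, 1 <= i <= 3 & walk e i x z.
  by move: zB; rewrite inE => /or3P[]; [exists 1 | exists 2 | exists 3].
have [j hj wj] : exists2 j, s - 1 <= j <= s & walk e j z y.
  move: zC; rewrite inE !(walk_converse e).
  by move=> /orP[]; [exists (s - 2).+1 | exists (s - 2).+2] => //; lia.
by exists (i + j); [lia | exact: walkD wi wj].
Qed.

Lemma flexible_walk x y m : m + 5 <= l ->
  (forall t, t <= 3 -> walk e (m + t) x y) -> False.
Proof.
move=> ml h; have [|k hk kw] := @window y x (l - m - 3); first lia.
case: (dense_walk D (x := x)).
have ->: l = (m + (l - m - k)) + k by lia.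
by apply: walkD kw; apply: h; lia.
Qed.

(** The walks from a to z have lengths 3, 4, 5 and 6. *)
Lemma three_shortcuts a b c z :
  shortcut e a b -> shortcut e b c -> shortcut e c z -> False.
Proof.
move=> /andP[]; rewrite -walk1 => a1 a2 /andP[]; rewrite -walk1 => b1 b2.
move=> /andP[]; rewrite -walk1 => c1 c2.
apply: (@flexible_walk a z 3); first by have := dense_len D; lia.
move=> [|[|[|[|t]]]] // _.
- exact: (walkD a1 (walkD b1 c1)).
- exact: (walkD a1 (walkD b1 c2)).
- exact: (walkD a1 (walkD b2 c2)).
- exact: (walkD a2 (walkD b2 c2)).
Qed.

End Windows.

Section Basics.
Variables (T : finType) (e : rel T) (l d g : nat).
Hypothesis D : dense e l d g.
Implicit Types (x y z : T).

Lemma card_outs2 x : 2 * d <= #|outs2 e x|.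
Proof.
have := two_levels D 0 x; congr (_ <= #|pred_of_set _|).
by apply/setP => y; rewrite !inE walk1.
Qed.

Lemma card_ins2 x : 2 * d <= #|ins2 e x|.
Proof.
have := two_levels (dense_converse D) 0 x; congr (_ <= #|pred_of_set _|).
by apply/setP => y; rewrite !inE walk1 (walk_converse e).
Qed.

Lemma no_walk2_back x y : e x y -> walk e 2 y x -> False.
Proof. by move=> xy /walk2P[z yz zx]; exact (dense_tri D xy yz zx). Qed.

Lemma walk2_asym x y : walk e 2 x y -> e y x -> False.
Proof. by move=> /walk2P[z xz zy] yx; exact (dense_tri D xz zy yx). Qed.

End Basics.

(** * Shortcuts whose end is far from their origin *)

(** Lengths 1 and 2 are already excluded by the absence of 2-cycles and of
    directed triangles, so the end of a shortcut has distance at least 5 to its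
    origin. *)
Definition remote (T : finType) (e : rel T) :=
  forall a c, shortcut e a c -> walk e 3 c a || walk e 4 c a -> False.

Lemma remote_converse (T : finType) (e : rel T) : remote e -> remote (converse e).
Proof.
by move=> h a c; rewrite shortcut_converse !(walk_converse e) => /h.
Qed.

Section Remote.
Variables (T : finType) (e : rel T) (l d g : nat).
Hypothesis D : dense e l d g.
Hypothesis R : remote e.
Implicit Types (x y z : T).

Let asym := dense_asym D.
Let tri := dense_tri D.
Let dg := dense_gap D.
Let dn := dense_card D.
Let douts := dense_out D.
Let dins := dense_in D.

Lemma remote_disjoint a c : shortcut e a c -> forall u,
  e c u || walk e 2 c u -> e u a || walk e 2 u a -> False.
Proof.
move=> ac u cu ua; have /andP[ec _] := ac.
have := R ac; move: cu ua => /orP[cu|cu] /orP[ua|ua].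
- by move=> _; exact (tri ec cu ua).
- by rewrite (walkS cu ua); apply.
- by rewrite (walk_rcons cu ua); apply.
- by rewrite (walkD cu ua) orbT; apply.
Qed.

(** Otherwise there is a shortcut c -> p with p a sink of N+(c), and three_shortcuts
    makes N+(p) and N-(a) independent.  The second out-neighbours Z of p must
    meet the second in-neighbours Q of a in many vertices, else N+(c) and N+(p)
    violate expansion.  Hence every vertex of N+(p) reaches every vertex of N-(a)
    in two steps, which keeps N-(c) away from N-(a).  Then N-(c), N+(c), N+(p),
    N-(a) and the intersection of Z and Q are disjoint, which is too much. *)
Lemma remote_outs_indep a c : shortcut e a c ->
  forall x y, e c x -> e c y -> e x y -> False.
Proof.
move=> ac x y cx cy xy; have /andP[eac _] := ac.
have [p cp sinkp] := shortcut_sink D (shortcutP cx xy cy).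
have /andP[ecp _] := cp.
have indp u v : e p u -> e p v -> e u v -> False.
  by move=> pu pv uv; exact (three_shortcuts D ac cp (shortcutP pu uv pv)).
have inda u v : e u a -> e v a -> e u v -> False.
  by move=> ua va uv; exact (three_shortcuts D (shortcutP uv va ua) ac cp).
have dac := remote_disjoint ac; have dcp := remote_disjoint cp.
pose Z u := walk e 2 p u && ~~ e p u.
pose Q u := walk e 2 u a && ~~ e u a.
have cZ : #|[set u | Z u]| <= d + g.
  count [:: outs e p; [set u | Z u]; ins2 e c] (@nil {set T}) 1.
    by have := card_ins2 D c; have := douts p; cards.
  by move: (dcp u); rewrite /Z; truth_table.
have cQ : #|[set u | Q u]| <= d + g.
  count [:: ins e a; [set u | Q u]; outs2 e c] (@nil {set T}) 1.
    by have := card_outs2 D c; have := dins a; cards.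
  by move: (dac u); rewrite /Q; truth_table.
have pZ u w : e p u -> e u w -> Z w.
  move=> pu uw; rewrite /Z (walk2 pu uw) /=; apply/negP => pw; exact (indp _ _ pu pw uw).
have aQ u w : e u a -> e w u -> Q w.
  move=> ua wu; rewrite /Q (walk2 wu ua) /=; apply/negP => wa; exact (inda _ _ wa ua wu).
have Za u : Z u -> e u a -> False.
  move=> /andP[pu _] ua; apply: (R ac).
  by rewrite (walk_rcons (walkS ecp pu) ua) orbT.
have [small|big] := leqP #|[set u | Z u && Q u]| (10 * g).
  pose X := [set u | e c u || e p u].
  pose Y := [set u | ~~ (e u a || walk e 2 u a) || (Z u && Q u)].
  have cX : 2 * d <= #|X|.
    count [:: outs e c; outs e p] [:: X] 0.
      by have := douts c; have := douts p; cards.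
    by move: (sinkp u); truth_table.
  have cY : #|Y| <= 2 * d + 11 * g.
    count [:: Y; ins2 e a] [:: [set u | Z u && Q u]] 1.
      by have := card_ins2 D a; cards.
    truth_table.
  suff h : 5 * d + 3 * #|X| <= 5 * #|Y| by cards.
  apply: (expansion D); first cards.
    move=> u; rewrite !inE => /orP[cu|pu].
      by move: (dac u); rewrite cu; truth_table.
    by move: (dac u); rewrite (walk2 ecp pu); truth_table.
  move=> u w; rewrite !inE => /orP[cu|pu] uw.
    by move: (dac w); rewrite (walk2 cu uw); truth_table.
  have zw := pZ _ _ pu uw; move: (Za w zw); rewrite zw /Q /=; truth_table.
(* Z and Q have at most d + g elements each, and every N+(u) misses at most g of
   Z, every N-(v) at most g of Q. *)
have link u v : e p u -> e v a -> exists2 w, e u w & e w v.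
  move=> pu va; suff: [exists w, e u w && e w v].
    by case/existsP=> w /andP[]; exists w.
  apply: contraT; rewrite negb_exists => /forallP h.
  count [:: [set w | Z w && Q w]; outs e u; ins e v] [:: [set w | Z w]; [set w | Q w]] 0.
    by have := douts u; have := dins v; cards.
  by move: (h u0) (pZ u u0 pu) (aQ v u0 va); truth_table.
have [u pu] := out_nonempty D p.
count [:: ins e c; outs e c; outs e p; ins e a; [set w | Z w && Q w]] (@nil {set T}) 1.
  by have := douts c; have := dins c; have := douts p; have := dins a; cards.
have ins_c v : e v a -> e v c -> False.
  move=> va vc; have [w uw wv] := link u v pu va.
  apply: (R (shortcutP va eac vc)).
  by rewrite (walkS ecp (walk3 pu uw wv)) orbT.
have := ins_c u0; have := asym (x := u0) (y := c); have := dcp u0.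
have := dac u0; have := Za u0; have := sinkp u0.
have := @tri c p u0 ecp.
have w2 := @walk2 _ e c p u0 ecp.
by rewrite /Z /Q; move: w2; truth_table.
Qed.
End Remote.

Section RemoteNeighbours.
Variables (T : finType) (e : rel T) (l d g : nat).
Hypothesis D : dense e l d g.
Hypothesis R : remote e.
Implicit Types (x y z : T).

Let asym := dense_asym D.
Let tri := dense_tri D.
Let dg := dense_gap D.
Let dn := dense_card D.
Let douts := dense_out D.
Let dins := dense_in D.

Lemma remote_ins_indep a c : shortcut e a c ->
  forall x y, e x a -> e y a -> e x y -> False.
Proof.
rewrite -shortcut_converse => ca x y xa ya xy.
exact (remote_outs_indep (dense_converse D) (remote_converse R) ca (x := y) (y := x) ya xa xy).
Qed.

(** If no edge joined N+(x) to N-(y), then the edges leaving N+(c) and N+(x) would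
    avoid both N-(a) and N-(y). *)
Lemma remote_walk3 a c x y : shortcut e a c -> e c x -> e y a -> walk e 3 x y.
Proof.
move=> ac cx ya; apply: contraT => no.
have dac := remote_disjoint D R ac.
have indc u v := remote_outs_indep D R ac (x := u) (y := v).
have inda u v := remote_ins_indep ac (x := u) (y := v).
pose X := [set u | e c u || e x u]; pose Y := [set u | ~~ (e u a || e u y)].
have cX : 2 * d <= #|X|.
  count [:: outs e c; outs e x] [:: X] 0.
    by have := douts c; have := douts x; cards.
  by move: (indc x u cx); truth_table.
have cY : #|Y| <= 2 * d + g.
  count [:: Y; ins e a; ins e y] (@nil {set T}) 1.
    by have := dins a; have := dins y; cards.
  by move: (inda u y); rewrite ya; truth_table.
suff h : 5 * d + 3 * #|X| <= 5 * #|Y| by cards.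
apply: (expansion D); first cards.
  move=> u; rewrite !inE => /orP[cu|xu].
    by move: (dac u) (@walk2 _ e u y a); rewrite cu ya; truth_table.
  by move: (dac u) (@walk2 _ e u y a); rewrite (walk2 cx xu) ya orbT; truth_table.
move=> u w; rewrite !inE => /orP[cu|xu] uw.
  by move: (dac w) (@walk2 _ e w y a); rewrite (walk2 cu uw) ya orbT; truth_table.
apply/negP => /orP[wa|wy].
  by apply: (dac u); rewrite ?(walk2 cx xu) ?(walk2 uw wa) orbT.
by case/negP: no; exact: walk3 xu uw wy.
Qed.

Lemma remote_outs_disjoint a c x : shortcut e a c -> e a x -> e c x -> False.
Proof.
move=> ac ax cx; have /andP[eac _] := ac.
have [y ya] := out_nonempty (dense_converse D) a.
apply: (R (shortcutP eac cx ax)).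
by rewrite (walk_rcons (remote_walk3 ac cx ya) ya) orbT.
Qed.

Lemma remote_ins_disjoint a c x : shortcut e a c -> e x a -> e x c -> False.
Proof.
move=> ac xa xc; have /andP[eac _] := ac.
have [y cy] := out_nonempty D c.
apply: (R (shortcutP xa eac xc)).
by rewrite (walkS cy (remote_walk3 ac cy xa)) orbT.
Qed.

Section Middle.
Variables a b c : T.
Hypotheses (ab : e a b) (bc : e b c) (eac : e a c).
Let ac := shortcutP ab bc eac.
Let dac := remote_disjoint D R ac.

(** Such an x makes b -> x a shortcut, so b is far from x.  Then N-(b) avoids
    N+(c), N+(x), N-(a) and everything that N+(x) sends edges to; so the edges
    from N+(c) and N+(x) have too few targets. *)
Lemma middle_outs x : e b x -> e c x -> False.
Proof.
move=> bx cx; have sbx := shortcutP bc cx bx.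
have indc u v := remote_outs_indep D R ac (x := u) (y := v).
have n1 u : e c u -> e u b -> False by move=> cu ub; exact (tri bc cu ub).
have n2 u : e x u -> e u b -> False by move=> xu ub; exact (tri bx xu ub).
have n3 u : e u a -> e u b -> False.
  move=> ua ub; apply: (R sbx).
  by rewrite (walk_rcons (remote_walk3 ac cx ua) ub) orbT.
pose X := [set u | e c u || e x u].
pose E := [set u | (e c u || walk e 2 c u) && e u b].
pose Y := [set u | ~~ (e u b || e u a) || ((e c u || walk e 2 c u) && e u b)].
have cX : 2 * d <= #|X|.
  count [:: outs e c; outs e x] [:: X] 0.
    by have := douts c; have := douts x; cards.
  by move: (indc x u cx); truth_table.
have cE : #|E| <= g.
  count [:: outs e c; outs e x; E; ins2 e a] (@nil {set T}) 1.
    by have := douts c; have := douts x; have := card_ins2 D a; cards.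
  move: (@dac u) (indc x u cx) (n1 u) (n2 u) (@walk2 _ e c x u cx).
  by truth_table.
have cY : #|Y| <= 2 * d + 2 * g.
  count [:: Y; ins e b; ins e a] [:: E] 1.
    by have := dins a; have := dins b; cards.
  by move: (n3 u); truth_table.
suff h : 5 * d + 3 * #|X| <= 5 * #|Y| by cards.
apply: (expansion D); first cards.
  move=> u; rewrite !inE => cu.
  have cu2 : e c u || walk e 2 c u.
    by case/orP: cu => [->//|xu]; rewrite (walk2 cx xu) orbT.
  by move: (dac cu2); rewrite cu2; truth_table.
move=> u w; rewrite !inE => /orP[cu|xu] uw.
  by move: (@dac w); rewrite (walk2 cu uw) orbT; truth_table.
have wa : e w a -> False.
  by move=> wa; apply: (@dac u); rewrite ?(walk2 cx xu) ?(walk2 uw wa) orbT.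
have wb : e w b -> False.
  by move=> wb; apply: (R sbx); rewrite (walk3 xu uw wb).
by move: wa wb; truth_table.
Qed.

(** A common out-neighbour u of a and b is the end of the shortcut a -> u, so its
    edges avoid the in-ball of a, as do those of N+(c). *)
Lemma middle_common_outs : d <= #|[set u | e a u && e b u]| + 2 * g -> False.
Proof.
move=> big.
have outab u : e a u -> e b u -> forall w, e u w -> e w a || walk e 2 w a -> False.
  by move=> au bu w uw; apply: (remote_disjoint D R (shortcutP ab bu au)); rewrite uw.
pose X := [set u | e c u || (e a u && e b u)].
pose Y := [set u | ~~ (e u a || walk e 2 u a)].
have cX : 2 * d <= #|X| + 2 * g.
  count [:: outs e c; [set u | e a u && e b u]] [:: X] 0.
    by have := douts c; cards.
  by move: (remote_outs_disjoint (x := u) ac); truth_table.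
have cY : #|Y| <= 2 * d + g.
  count [:: Y; ins2 e a] (@nil {set T}) 1; last by truth_table.
  by have := card_ins2 D a; cards.
suff h : 5 * d + 3 * #|X| <= 5 * #|Y| by cards.
apply: (expansion D); first cards.
  move=> u; rewrite !inE => cu.
  move: (@dac u) (@asym a u) (@no_walk2_back _ _ _ _ _ D a u) cu; truth_table.
move=> u w; rewrite !inE => /orP[cu|/andP[au bu]] uw.
  by move: (@dac w); rewrite (walk2 cu uw) orbT; truth_table.
by move: (outab u au bu w uw); truth_table.
Qed.

(** Here a -> b is a shortcut as well, so that N+(b) avoids the in-ball of a and
    has to share most of its vertices with N+(a). *)
Lemma middle_meet p : e a p -> e p b -> False.
Proof.
move=> ap pb; have sab := shortcutP ap pb ab.
have dab := remote_disjoint D R sab.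
apply: middle_common_outs.
count [:: outs e a; outs e b; ins2 e a; outs e c] [:: [set u | e a u && e b u]] 1.
  have := douts a; have := douts b; have := douts c; have := card_ins2 D a; cards.
move: (dab u) (@dac u) (@middle_outs u) (remote_outs_disjoint (x := u) ac).
move: (@asym a u) (@no_walk2_back _ _ _ _ _ D a u).
by truth_table.
Qed.
End Middle.

End RemoteNeighbours.

Section NoShortcut.
Variables (T : finType) (e : rel T) (l d g : nat).
Hypothesis D : dense e l d g.
Hypothesis R : remote e.

(** By middle_meet for the reversed graph, N+(b) avoids N-(c); as it also avoids
    N+(c) and N-(a), only N+(a) is left for it. *)
Lemma remote_no_shortcut a c : shortcut e a c -> False.
Proof.
move=> ac; have [b [ab bc eac]] := shortcut_mid ac.
have D' := dense_converse D; have R' := remote_converse R.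
have dac := remote_disjoint D R ac.
have bc0 u : e b u -> e u c -> False.
  by move=> bu uc; exact (middle_meet D' R' (a := c) (b := b) (c := a) bc ab eac uc bu).
apply: (middle_common_outs D R ab bc eac).
count [:: outs e a; outs e b; outs e c; ins e a; ins e c] 
  [:: [set u | e a u && e b u]; [set u | e a u && e u c]] 1.
  count [:: [set u | e a u && e u c]; outs2 e c; ins2 e a] (@nil {set T}) 1.
    have := card_ins2 D a; have := card_outs2 D c.
    have := dense_out D a; have := dense_out D b; have := dense_out D c.
    by have := dense_in D a; have := dense_in D c; have := dense_card D; cards.
  move: (dac u) (@dense_asym _ _ _ _ _ D a u) (@no_walk2_back _ _ _ _ _ D a u).
  move: (@dense_asym _ _ _ _ _ D c u) (@walk2_asym _ _ _ _ _ D c u).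
  by truth_table.
move: (dac u) (bc0 u) (@dense_asym _ _ _ _ _ D a u) (@dense_asym _ _ _ _ _ D c u).
move: (@dense_tri _ _ _ _ _ D a b u ab).
move: (middle_outs D R ab bc eac (x := u)) (remote_outs_disjoint D R ac (x := u)).
move: (remote_ins_disjoint D R ac (x := u)).
by truth_table.
Qed.
End NoShortcut.

(** * Closed walks of length 9 *)

Definition no_square (T : finType) (e : rel T) v := walk e 4 v v -> False.

(** What the absence of closed 9-walks adds: 9 = 4 + 5 is the reason for both
    fields. *)
Record no_nine (T : finType) (e : rel T) : Prop := NoNine {
  no_nine3 : forall a c, shortcut e a c -> walk e 3 c a -> False;
  no_nine5 : forall v, walk e 5 v v -> no_square e v }.

Lemma no_nine_converse (T : finType) (e : rel T) : no_nine e -> no_nine (converse e).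
Proof.
case=> n3 n5; split.
  by move=> a c; rewrite shortcut_converse (walk_converse e); exact: n3.
by move=> v; rewrite /no_square !(walk_converse e); exact: n5.
Qed.

Section NoNine.
Variables (T : finType) (e : rel T) (l d g : nat).
Hypothesis D : dense e l d g.
Hypothesis N : no_nine e.
Implicit Types (x y z : T).

Let asym := dense_asym D.
Let tri := dense_tri D.
Let dg := dense_gap D.
Let dn := dense_card D.
Let douts := dense_out D.
Let dins := dense_in D.

Lemma no_square_disjoint v : no_square e v -> forall u,
  e v u || walk e 2 v u -> e u v || walk e 2 u v -> False.
Proof.
move=> nv u /orP[vu|vu] /orP[uv|uv].
- exact (asym vu uv).
- exact (no_walk2_back D vu uv).
- exact (walk2_asym D vu uv).
- exact (nv (walkD vu uv)).
Qed.

Section Sink.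
Variables a c : T.
Hypotheses (na : no_square e a) (ac : shortcut e a c)
  (sinkc : forall y, e a y -> e c y -> False).

(** Otherwise the out-balls of a and of c both avoid the in-ball of a, which
    confines the edges from N+(a) and N+(c) to half of the graph. *)
Lemma sink_walk4 : walk e 4 c a.
Proof.
apply: contraT => no; have /andP[eac _] := ac.
have da := no_square_disjoint na.
have dac u : e c u || walk e 2 c u -> e u a || walk e 2 u a -> False.
  move=> /orP[cu|cu] /orP[ua|ua].
  - exact (tri eac cu ua).
  - exact (no_nine3 N ac (walkS cu ua)).
  - exact (no_nine3 N ac (walk_rcons cu ua)).
  - by case/negP: no; exact: walkD cu ua.
pose X := [set u | e a u || e c u].
pose Y := [set u | ~~ (e u a || walk e 2 u a)].
have cX : 2 * d <= #|X|.
  count [:: outs e a; outs e c] [:: X] 0.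
    by have := douts a; have := douts c; cards.
  by move: (sinkc (y := u)); truth_table.
have cY : #|Y| <= 2 * d + g.
  count [:: Y; ins2 e a] (@nil {set T}) 1; last by truth_table.
  by have := card_ins2 D a; cards.
suff h : 5 * d + 3 * #|X| <= 5 * #|Y| by cards.
apply: (expansion D); first cards.
  by move=> u; rewrite !inE; move: (da u) (dac u); truth_table.
move=> u w; rewrite !inE => /orP[au|cu] uw.
  by move: (da w); rewrite (walk2 au uw) orbT; truth_table.
by move: (dac w); rewrite (walk2 cu uw) orbT; truth_table.
Qed.

Lemma sink_no_square : no_square e c.
Proof.
have /andP[eac _] := ac.
exact (no_nine5 N (@walk_rcons _ e 4 _ _ _ sink_walk4 eac)).
Qed.

End Sink.

(** Otherwise there is a shortcut c -> s with s a sink of N+(c), and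
    three_shortcuts makes N+(s) and N-(a) independent.  Let Z and B be the second
    out-neighbours of s and the second in-neighbours of a.  By expansion N+(s)
    meets B in many vertices, and counting then gives that N-(a) is part of Z and
    N+(s) part of B: almost all edges from N+(s) go to N-(a).  For an edge p -> q
    from N+(s) to N-(a), the edges leaving N+(q) avoid N-(p), because p lies on
    no closed 4-walk, as well as N-(a) and most of N+(s), against expansion. *)
Lemma sink_outs_indep a c : no_square e a -> shortcut e a c ->
  (forall y, e a y -> e c y -> False) ->
  forall x y, e c x -> e c y -> e x y -> False.
Proof.
move=> na ac sinkc x y cx cy xy; have /andP[eac _] := ac.
have nc := sink_no_square na ac sinkc.
have [s cs sinks] := shortcut_sink D (shortcutP cx xy cy).
have ns := sink_no_square nc cs sinks; have /andP[ecs _] := cs.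
have inds u v : e s u -> e s v -> e u v -> False.
  by move=> su sv uv; exact (three_shortcuts D ac cs (shortcutP su uv sv)).
have inda u v : e u a -> e v a -> e u v -> False.
  by move=> ua va uv; exact (three_shortcuts D (shortcutP uv va ua) ac cs).
have da := no_square_disjoint na; have dc := no_square_disjoint nc.
have ds := no_square_disjoint ns.
have sa u : e s u -> e u a -> False.
  by move=> su ua; exact (no_nine3 N ac (walk3 ecs su ua)).
have ca2 u : e c u -> walk e 2 u a -> False.
  by move=> cu ua; exact (no_nine3 N ac (walkS cu ua)).
have ca u : e c u -> e u a -> False by move=> cu ua; exact (tri eac cu ua).
pose Z u := walk e 2 s u && ~~ e s u.
pose B u := walk e 2 u a && ~~ e u a.
have cZ : #|[set u | Z u]| <= d + g.
  count [:: outs e s; [set u | Z u]; ins2 e s] (@nil {set T}) 1.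
    by have := card_ins2 D s; have := douts s; cards.
  by move: (ds u); rewrite /Z; truth_table.
have cB : #|[set u | B u]| <= d + g.
  count [:: ins e a; [set u | B u]; outs2 e a] (@nil {set T}) 1.
    by have := card_outs2 D a; have := dins a; cards.
  by move: (da u); rewrite /B; truth_table.
have sZ u w : e s u -> e u w -> Z w.
  move=> su uw; rewrite /Z (walk2 su uw) /=; apply/negP => sw; exact (inds _ _ su sw uw).
have aB u w : e u a -> e w u -> B w.
  move=> ua wu; rewrite /B (walk2 wu ua) /=; apply/negP => wa; exact (inda _ _ wa ua wu).
have big : 10 * g < #|[set u | e s u && B u]|.
  rewrite ltnNge; apply/negP => small.
  pose E := [set u | [&& walk e 2 c u, ~~ e c u & ~~ e s u]].
  pose X := [set u | e a u || e c u].
  (* E consists of the few second out-neighbours of c outside N+(s). *)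
  pose Y := [set u | [|| ~~ (e u a || walk e 2 u a), e s u && B u |
                      [&& walk e 2 c u, ~~ e c u & ~~ e s u]]].
  have cX : 2 * d <= #|X|.
    count [:: outs e a; outs e c] [:: X] 0.
      by have := douts a; have := douts c; cards.
    by move: (sinkc u); truth_table.
  have cE : #|E| <= g.
    count [:: E; outs e c; outs e s; ins2 e c] (@nil {set T}) 1.
      by have := douts c; have := douts s; have := card_ins2 D c; cards.
    by move: (dc u) (sinks u) (@walk2 _ e c s u ecs); truth_table.
  have cY : #|Y| <= 2 * d + 12 * g.
    count [:: Y; ins2 e a] [:: [set u | e s u && B u]; E] 1.
      by have := card_ins2 D a; cards.
    by truth_table.
  suff h : 5 * d + 3 * #|X| <= 5 * #|Y| by cards.
  apply: (expansion D); first cards.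
    by move=> u; rewrite !inE; move: (da u) (ca u) (ca2 u); truth_table.
  move=> u w; rewrite !inE => /orP[au|cu] uw.
    by move: (da w); rewrite (walk2 au uw) orbT; truth_table.
  by move: (ca2 w) (ca w) (sa w); rewrite (walk2 cu uw) /B; truth_table.
have insZ y' : e y' a -> exists2 u, e s u & e u y'.
  move=> ya; suff: [exists w, e s w && e w y'].
    by case/existsP=> w /andP[]; exists w.
  apply: contraT; rewrite negb_exists => /forallP h.
  count [:: [set w | e s w && B w]; ins e y'] [:: [set w | B w]] 0.
    by have := dins y'; cards.
  by move: (h u) (aB y' u ya); truth_table.
have ZB u : e u a -> Z u.
  by move=> ua; have [v sv vu] := insZ u ua; exact: sZ sv vu.
have meets u : e s u -> exists2 v, e u v & e v a.
  move=> su; suff: [exists v, e u v && e v a].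
    by case/existsP=> w /andP[]; exists w.
  apply: contraT; rewrite negb_exists => /forallP h.
  count [:: outs e u; ins e a] [:: [set w | Z w]] 0.
    by have := douts u; have := dins a; cards.
  by move: (h u0) (sZ u u0 su) (ZB u0); truth_table.
have sB u : e s u -> B u.
  move=> su; have [v uv va] := meets u su; exact: aB va uv.
(* The vertices a, c, s, p, q form a closed walk of length 5. *)
have [p sp] := out_nonempty D s.
have [q pq qa] := meets p sp.
have np : no_square e p.
  exact (no_nine5 N (walkS pq (walkS qa (walk3 eac ecs sp)))).
(* Leaving out B ensures that the edges from X avoid N-(a). *)
pose X := [set u | e q u && ~~ B u].
pose E := [set u | e q u && B u].
pose Y := [set u | ~~ [|| e u p, e u a | e s u && e u q]].
have cE : #|E| <= g.
  count [:: ins e q; E] [:: [set u | B u]] 0.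
    by have := dins q; cards.
  by move: (asym (x := u) (y := q)) (aB q u qa); truth_table.
have cX : d <= #|X| + g.
  count [:: outs e q] [:: X; E] 0; last by truth_table.
  by have := douts q; cards.
have c1 : #|[set u | e u p && e u a]| <= g.
  count [:: [set u | e u p && e u a]; outs e p] [:: [set u | Z u]] 0.
    by have := douts p; cards.
  by move: (asym (x := u) (y := p)) (ZB u) (sZ p u sp); truth_table.
have c2 : d <= #|[set u | e s u && e u q]| + g.
  count [:: outs e s; ins e q] [:: [set u | B u]; [set u | e s u && e u q]] 0.
    by have := douts s; have := dins q; cards.
  by move: (sB u) (aB q u qa); truth_table.
have cY : #|Y| <= d + 3 * g.
  count [:: Y; ins e p; ins e a; [set u | e s u && e u q]] [:: [set u | e u p && e u a]] 1.
    by have := dins p; have := dins a; cards.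
  by move: (sa u) (inds u p); rewrite sp; truth_table.
suff h : 5 * d + 3 * #|X| <= 5 * #|Y| by cards.
apply: (expansion D); first cards.
  move=> u; rewrite !inE; move: (sB u) (inda q u qa) (@tri q u p).
  by rewrite pq; truth_table.
move=> u w; rewrite !inE => /andP[qu nBu] uw.
have h1 : e w p -> False.
  by move=> wp; exact (np (walkS pq (walk3 qu uw wp))).
have h2 : e w a -> False by move=> wa; move: nBu; rewrite (aB w u wa uw).
have h3 : e w q -> False by move=> wq; exact (tri qu uw wq).
by move: h1 h2 h3; truth_table.
Qed.

End NoNine.

Section NoNineSquare.
Variables (T : finType) (e : rel T) (l d g : nat).
Hypothesis D : dense e l d g.
Hypothesis N : no_nine e.
Implicit Types (x y z : T).

Let asym := dense_asym D.
Let tri := dense_tri D.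
Let dg := dense_gap D.
Let dn := dense_card D.
Let douts := dense_out D.
Let dins := dense_in D.

(** Now N+(c) is independent too.  The second out-neighbours Z of c and the second
    in-neighbours B of a share many vertices, so that every p in N+(c) reaches
    every q in N-(a) through some w.  Outside N+(c), Z, B and N-(a) lies a set V
    of more than 4 * g vertices, and N-(p) as well as N+(q) contain all but 2 * g
    of them.  A common element u gives the closed walk q -> u -> p -> w -> q,
    although q lies on a closed 5-walk. *)
Lemma sink_ins_not_indep a c : no_square e a -> shortcut e a c ->
  (forall y, e a y -> e c y -> False) ->
  (forall x y, e x a -> e y a -> e x y -> False) -> False.
Proof.
move=> na ac sinkc inda; have /andP[eac _] := ac.
have nc := sink_no_square D N na ac sinkc.
have indc := sink_outs_indep D N na ac sinkc.
have da := no_square_disjoint D na; have dc := no_square_disjoint D nc.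
have ca u : e c u -> e u a -> False by move=> cu ua; exact (tri eac cu ua).
have ca2 u : e c u -> walk e 2 u a -> False.
  by move=> cu ua; exact (no_nine3 N ac (walkS cu ua)).
have c2a u : walk e 2 c u -> e u a -> False.
  by move=> cu ua; exact (no_nine3 N ac (walk_rcons cu ua)).
pose Z u := walk e 2 c u && ~~ e c u.
pose B u := walk e 2 u a && ~~ e u a.
have cZ0 : 2 * d + #|outs e c| + #|[set u | Z u]| <= #|[set: T]|.
  count [:: outs e c; [set u | Z u]; ins2 e c] (@nil {set T}) 1.
    by have := card_ins2 D c; cards.
  by move: (dc u); rewrite /Z; truth_table.
have cB0 : 2 * d + #|ins e a| + #|[set u | B u]| <= #|[set: T]|.
  count [:: ins e a; [set u | B u]; outs2 e a] (@nil {set T}) 1.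
    by have := card_outs2 D a; cards.
  by move: (da u); rewrite /B; truth_table.
have cZ : #|[set u | Z u]| <= d + g by have := douts c; cards.
have cB : #|[set u | B u]| <= d + g by have := dins a; cards.
have cZu u w : e c u -> e u w -> Z w.
  move=> cu uw; rewrite /Z (walk2 cu uw) /=; apply/negP => cw; exact (indc _ _ cu cw uw).
have aB u w : e u a -> e w u -> B w.
  move=> ua wu; rewrite /B (walk2 wu ua) /=; apply/negP => wa; exact (inda _ _ wa ua wu).
have big : 10 * g < #|[set u | Z u && B u]|.
  rewrite ltnNge; apply/negP => small.
  pose X := [set u | e a u || e c u].
  pose Y := [set u | ~~ (e u a || walk e 2 u a) || Z u && B u].
  have cX : 2 * d <= #|X|.
    count [:: outs e a; outs e c] [:: X] 0.
      by have := douts a; have := douts c; cards.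
    by move: (sinkc u); truth_table.
  have cY : #|Y| <= 2 * d + 11 * g.
    count [:: Y; ins2 e a] [:: [set u | Z u && B u]] 1; last by truth_table.
    by have := card_ins2 D a; cards.
  suff h : 5 * d + 3 * #|X| <= 5 * #|Y| by cards.
  apply: (expansion D); first cards.
    by move=> u; rewrite !inE; move: (da u) (ca u) (ca2 u); truth_table.
  move=> u w; rewrite !inE => /orP[au|cu] uw.
    by move: (da w); rewrite (walk2 au uw) orbT; truth_table.
  have zw := cZu u w cu uw; move: zw (c2a w); rewrite (walk2 cu uw) /B => ->; truth_table.
have link u v : e c u -> e v a -> exists2 w, e u w & e w v.
  move=> cu va; suff: [exists w, e u w && e w v].
    by case/existsP=> w /andP[]; exists w.
  apply: contraT; rewrite negb_exists => /forallP h.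
  count [:: [set w | Z w && B w]; outs e u; ins e v] [:: [set w | Z w]; [set w | B w]] 0.
    by have := douts u; have := dins v; cards.
  by move: (h u0) (cZu u u0 cu) (aB v u0 va); truth_table.
have [p cp] := out_nonempty D c; have [q qa] : exists q, e q a := out_nonempty (dense_converse D) a.
have [w pw wq] := link p q cp qa.
have nq : no_square e q.
  exact (no_nine5 N (walkS qa (walkS eac (walk3 cp pw wq)))).
have disj u : e q u -> e u p -> False.
  by move=> qu up; exact (nq (walkS qu (walk3 up pw wq))).
have noedge u v : e c u -> e v a -> e v u -> False.
  by move=> cu va vu; have [x ux xv] := link u v cu va; exact (tri vu ux xv).
have insp : #|[set u | Z u && e u p]| <= g.
  count [:: [set u | Z u && e u p]; outs e p] [:: [set u | Z u]] 0.
    by have := douts p; cards.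
  by move: (asym (x := u) (y := p)) (cZu p u cp); truth_table.
have outsq : #|[set u | B u && e q u]| <= g.
  count [:: [set u | B u && e q u]; ins e q] [:: [set u | B u]] 0.
    by have := dins q; cards.
  by move: (asym (x := u) (y := q)) (aB q u qa); truth_table.
have dZ : d <= #|[set u | Z u]|.
  count [:: outs e p] [:: [set u | Z u]] 0; first by have := douts p; cards.
  by move: (cZu p u cp); truth_table.
have dB : d <= #|[set u | B u]|.
  count [:: ins e q] [:: [set u | B u]] 0; first by have := dins q; cards.
  by move: (aB q u qa); truth_table.
pose V u := ~~ [|| e c u, Z u, B u | e u a].
have Vp : #|[set u | V u && ~~ e u p]| <= 2 * g.
  count [:: [set u | V u && ~~ e u p]; ins e p; outs e c; [set u | Z u]; ins e a]
    [:: [set u | Z u && e u p]] 1.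
    by have := douts c; have := dins p; have := dins a; cards.
  move: (indc u p) (noedge p u cp) (c2a u) (ca u); rewrite cp /V /Z.
  by truth_table.
have Vq : #|[set u | V u && ~~ e q u]| <= 2 * g.
  count [:: [set u | V u && ~~ e q u]; outs e q; outs e c; [set u | B u]; ins e a]
    [:: [set u | B u && e q u]] 1.
    by have := douts c; have := douts q; have := dins a; cards.
  move: (inda q u) (noedge u q) (ca2 u) (ca u); rewrite qa /V /B.
  by truth_table.
count [:: [set u | V u]] [:: [set u | V u && ~~ e u p]; [set u | V u && ~~ e q u]] 0.
  count [:: [set: T]; [set u | Z u && B u]]
    [:: [set u | V u]; outs e c; [set u | Z u]; [set u | B u]; ins e a] 0.
    by cards.
  by rewrite /V; truth_table.
by move: (disj u); truth_table.
Qed.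

End NoNineSquare.

Section NoNineWalk.
Variables (T : finType) (e : rel T) (l d g : nat).
Hypothesis D : dense e l d g.
Hypothesis N : no_nine e.

(** First c is moved to a sink c1 of N+(a), then a to a source a1 of N-(c1), which
    makes N-(a1) independent, and finally c1 to a sink c2 of N+(a1). *)
Lemma no_nine_walk4 a c : shortcut e a c -> walk e 4 c a -> False.
Proof.
move=> ac wca; have /andP[eac _] := ac.
have D' := dense_converse D; have N' := no_nine_converse N.
have na : no_square e a by exact (no_nine5 N (walkS eac wca)).
have [c1 ac1 sinkc1] := shortcut_sink D ac.
have nc1 := sink_no_square D N na ac1 sinkc1.
rewrite -shortcut_converse in ac1.
have nc1' : no_square (converse e) c1 by rewrite /no_square (walk_converse e).
have [a1 c1a1 sinka1] := shortcut_sink D' ac1.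
have na1 : no_square e a1.
  by have := sink_no_square D' N' nc1' c1a1 sinka1; rewrite /no_square (walk_converse e).
have ina1 := sink_outs_indep D' N' nc1' c1a1 sinka1.
rewrite shortcut_converse in c1a1.
have [c2 a1c2 sinkc2] := shortcut_sink D c1a1.
apply: (sink_ins_not_indep D N na1 a1c2 sinkc2) => x y xa ya xy.
exact (ina1 _ _ ya xa xy).
Qed.
End NoNineWalk.

(** * No shortcuts, and bipartiteness *)

Section Assembly.
Variables (T : finType) (e : rel T) (l d g : nat).
Hypothesis D : dense e l d g.

Lemma closed_combination x m i j : walk e m x x -> walk e m.+1 x x ->
  l = i * m + j * m.+1 -> False.
Proof.
move=> wm wm1 lE; apply: (dense_walk D (x := x)); rewrite lE.
exact: walkD (walk_mul i wm) (walk_mul j wm1).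
Qed.

Lemma shortcut_closed a c k :
  shortcut e a c -> walk e k c a -> walk e k.+1 a a /\ walk e k.+2 a a.
Proof.
by move=> /andP[ac ac2] ca; split; [exact: walkS ac ca | exact: (walkD ac2 ca)].
Qed.

(** Closed walks of lengths m and m + 1 add up to l if l %% m of the longer ones
    fit into l. *)
Lemma no_shortcut a c : 3 %| l -> ~~ (4 %| l) -> shortcut e a c -> False.
Proof.
move=> l3 l4 ac; have l9 := dense_len D.
have n3 a' c' : shortcut e a' c' -> walk e 3 c' a' -> False.
  move=> ac' wca; have [w4 w5] := shortcut_closed ac' wca.
  apply: (closed_combination (i := (l - 5 * (l %% 4)) %/ 4) (j := l %% 4) w4 w5).
  lia.
apply: (remote_no_shortcut D _ ac) => a' c' ac' /orP[/(n3 _ _ ac')//|w4].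
have [l15|l15] := leqP 15 l.
  have [w5 w6] := shortcut_closed ac' w4.
  apply: (closed_combination (i := (l - 6 * (l %% 5)) %/ 5) (j := l %% 5) w5 w6).
  lia.
have lE : l = 9 by lia.
have N : no_nine e.
  split=> [//|v w5 wv4]; apply: (dense_walk D (x := v)); rewrite lE.
  exact: (walkD w5 wv4).
exact (no_nine_walk4 D N ac' w4).
Qed.

(** The neighbourhoods of u and w are disjoint and cover almost everything; the
    bipartition tells whether a vertex has a neighbour in common with w or with
    u.  An edge inside one class would lie on a closed walk of length 5. *)
Lemma no_shortcut_bipartite : (forall a c, shortcut e a c -> False) -> bipartite e.
Proof.
move=> ns; have asym := dense_asym D; have tri := dense_tri D.
have trans x y z : e x y -> e y z -> e x z -> False.
  by move=> xy yz xz; exact (ns _ _ (shortcutP xy yz xz)).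
pose adj x y := e x y || e y x.
have adj_tri x y z : adj x y -> adj y z -> adj x z -> False.
  rewrite /adj; move: (tri x y z) (tri x z y) (trans x y z) (trans x z y).
  move: (trans y x z) (trans y z x) (trans z x y) (trans z y x).
  by truth_table.
have dg := dense_gap D; have dn := dense_card D.
have adj_card x : 2 * d <= #|[set y | adj x y]|.
  count [:: outs e x; ins e x] [:: [set y | adj x y]] 0.
    by have := dense_out D x; have := dense_in D x; cards.
  by rewrite /adj; move: (asym x u); truth_table.
(* Neighbourhoods of consecutive vertices are disjoint, so no vertex is in more
   than two of the five, while 5 * (2 * d) > 2 * n. *)
have no5 x y z t v : adj x y -> adj y z -> adj z t -> adj t v -> adj v x -> False.
  move=> xy yz zt tv vx.
  count [:: [set p | adj x p]; [set p | adj y p]; [set p | adj z p];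
            [set p | adj t p]; [set p | adj v p]] (@nil {set T}) 2.
    have := adj_card x; have := adj_card y; have := adj_card z.
    by have := adj_card t; have := adj_card v; cards.
  move: (adj_tri x y u xy) (adj_tri y z u yz) (adj_tri z t u zt) (adj_tri t v u tv).
  by move: (adj_tri v x u vx); truth_table.
have adjC x y : adj x y = adj y x by rewrite /adj orbC.
have [u _|none] := pickP (@predT T); last by exists set0 => x; have := none x.
have [w uw] := out_nonempty D u; have {}uw : adj u w by rewrite /adj uw.
exists [set x | [exists y, adj w y && adj x y]] => x y; rewrite -[underlying e x y]/(adj x y) => xy.
have meets z : ~~ [exists y, adj w y && adj z y] -> exists2 y, adj u y & adj z y.
  move=> hw; suff: [exists y, adj u y && adj z y] by case/existsP=> p /andP[]; exists p.
  apply: contraT => hu.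
  count [:: [set p | adj w p]; [set p | adj u p]; [set p | adj z p]] (@nil {set T}) 1.
    by have := adj_card w; have := adj_card u; have := adj_card z; cards.
  move: hw hu; rewrite !negb_exists => /forallP/(_ u0) hw /forallP/(_ u0) hu.
  by move: hw hu (adj_tri u w u0 uw); truth_table.
rewrite !inE; case: (boolP [exists _, _]) => hx; case: (boolP [exists _, _]) => hy //.
  have /existsP[p /andP[wp xp]] := hx; have /existsP[q /andP[wq yq]] := hy.
  by case: (no5 x p w q y); rewrite // adjC.
have [p up xp] := meets x hx; have [q uq yq] := meets y hy.
by case: (no5 x p u q y); rewrite // adjC.
Qed.
End Assembly.

Lemma min_semidegree_le (T : finType) (e : rel T) x :
  min_semidegree e <= minn (outdegree e x) (indegree e x).
Proof.
have h (s : seq T) : x \in s ->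
    \big[minn/#|T|]_(y <- s) minn (outdegree e y) (indegree e y)
      <= minn (outdegree e x) (indegree e x).
  elim: s => [//|y s IH]; rewrite inE big_cons => /predU1P[<-|/IH xs].
    exact: geq_minl.
  exact: leq_trans (geq_minr _ _) xs.
by apply: h; rewrite mem_index_enum.
Qed.

Import Order.TTheory GRing.Theory Num.Theory.
Local Open Scope ring_scope.

Theorem theorem1p6 (R : realType) (l : nat)
    (hl9 : (9 <= l)%N) (hl3 : (3 %| l)%N) (hl4 : ~~ (4 %| l)%N)
    (eps : R) (heps : 0 < eps) :
  exists2 gamma : R, 0 < gamma &
  exists n0 : nat, forall (T : finType) (e : rel T),
    oriented e -> (n0 <= #|T|)%N ->
    #|T|%:R / 4%:R - gamma * #|T|%:R <= (min_semidegree e)%:R ->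
    ~ has_closed_walk e l ->
    exists S : {set T},
      #|S|%:R <= eps * #|T|%:R /\ bipartite (induced e (~: S)).
Proof.
(* With g = n - 4 * d this gives g <= n / 500, hence 100 * g < d. *)
exists 2000%:R^-1; first by rewrite invr_gt0 ltr0n.
exists 1%N => T e [_ asym] n1 hdeg nowalk.
exists set0; split; first by rewrite cards0 mulr_ge0 // ltW.
set m := min_semidegree e in hdeg.
have {}hdeg : (499 * #|T| <= 2000 * m)%N.
  rewrite -(ler_nat R) !natrM; move: hdeg; lra.
have D : dense e l m (#|T| - 4 * m).
  have mle x := min_semidegree_le e x.
  have nw x : walk e l x x -> False by move/walk_closed; exact: nowalk.
  split=> //.
  - by move=> x y xy yx; move: (asym x y); rewrite xy yx.
  - move=> x y z xy yz zx; apply: (nw x).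
    rewrite -(divnK hl3); apply: walk_mul; exact: walk3 xy yz zx.
  - by move=> x; apply: leq_trans (mle x) _; exact: geq_minl.
  - by move=> x; apply: leq_trans (mle x) _; exact: geq_minr.
  - by rewrite cardsT; lia.
  - by lia.
have [A hA] : bipartite e.
  by apply: (no_shortcut_bipartite D) => a c; exact: no_shortcut D a c hl3 hl4.
by exists [set v | val v \in A] => x y xy; rewrite !inE; exact: hA.
Qed.
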